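(* Let $H$ be a real Hilbert space with origin $\theta$, let $r>0$, let $r\mathbb{B}=\{x\in H:\|x\|\le r\}$, $r\mathbb{B}^{\circ}=\{x\in H:\|x\|<r\}$, $r\mathbb{S}=\{x\in H:\|x\|=r\}$, and let $P_{r\mathbb{B}}:H\to r\mathbb{B}$ be the metric projection onto $r\mathbb{B}$. The Mordukhovich derivatives of $P_{r\mathbb{B}}$ at a point $\bar{x}\in H$ are given as follows. (I) If $\bar{x}\in r\mathbb{B}^{\circ}$, then $\widehat{D}^*P_{r\mathbb{B}}(\bar{x})(y)=\{y\}$ for every $y\in H$. (II) If $\bar{x}\in H\setminus r\mathbb{B}$, then $\widehat{D}^*P_{r\mathbb{B}}(\bar{x})(y)=\left\{\frac{r}{\|\bar{x}\|}\left(y-\frac{\langle y,\bar{x}\rangle}{\|\bar{x}\|^2}\bar{x}\right)\right\}$ for every $y\in H$. (III) If $\bar{x}\in r\mathbb{S}$, then (a) $\widehat{D}^*P_{r\mathbb{B}}(\bar{x})(\theta)=\{\theta\}$; (b) for any $y\in H\setminus\{\theta\}$, $\theta\in\widehat{D}^*P_{r\mathbb{B}}(\bar{x})(y)$ if and only if $y=\frac{\langle y,\bar{x}\rangle}{\|\bar{x}\|^2}\bar{x}$ and $\langle y,\bar{x}\rangle\le 0$; (c) $\widehat{D}^*P_{r\mathbb{B}}(\bar{x})(\bar{x})=\emptyset$.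
   Context: For a nonempty subset $\Omega$ of a real Hilbert space $X$ and $x\in\Omega$, the set of Fréchet normals is $\widehat{N}(x;\Omega)=\left\{z\in X:\limsup_{u\to x,\ u\in\Omega,\ u\ne x}\frac{\langle z,u-x\rangle}{\|u-x\|}\le 0\right\}$. For a single-valued mapping $f:H\to H$, $\bar x\in H$ and $y\in H$, the Mordukhovich derivative (Fréchet coderivative) of $f$ at $\bar x$ is the set $\widehat{D}^*f(\bar x)(y)=\{z\in H:(z,-y)\in\widehat{N}((\bar x,f(\bar x));\mathrm{gph} f)\}$, where $\mathrm{gph} f=\{(u,f(u)):u\in H\}\subseteq H\times H$ and $H\times H$ carries the inner product $\langle(x,y),(u,v)\rangle=\langle x,u\rangle+\langle y,v\rangle$. For a nonempty closed convex $C\subseteq H$, the metric projection $P_C(x)$ is the unique point of $C$ with $\|x-P_C(x)\|\le\|x-z\|$ for all $z\in C$; here $P_{r\mathbb{B}}$ is regarded as a mapping $H\to H$. *)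

(* Defs.v *)
From HB Require Import structures.
From mathcomp Require Import all_boot all_order all_algebra.
From mathcomp Require Import all_classical all_reals all_analysis.
From mathcomp Require Import ring lra.

Set Implicit Arguments.
Unset Strict Implicit.
Unset Printing Implicit Defensive.
Import Order.TTheory GRing.Theory Num.Theory.
Import numFieldNormedType.Exports.

Local Open Scope classical_set_scope.
Local Open Scope ring_scope.

HB.mixin Record NormedModule_isPreHilbert (R : realType) H
    & NormedModule R H := {
  hinner : {dot H for idfun};
  hnormE : forall x : H, `|x| = Num.sqrt (hinner x x)
}.

#[short(type="preHilbertType")]
HB.structure Definition PreHilbert (R : realType) :=
  {H of NormedModule R H & NormedModule_isPreHilbert R H}.

#[short(type="hilbertType")]
HB.structure Definition Hilbert (R : realType) :=
  {H of PreHilbert R H & Complete H}.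

Section DotNorm.
Variables (R : realType) (U : lmodType R) (f : {dot U for idfun}).
Implicit Types x y : U.

Lemma dotC x y : f x y = f y x.
Proof. by have := @hermitian_subproof _ _ _ _ f x y; rewrite expr0 mul1r. Qed.

Lemma dotDr x y z : f x (y + z) = f x y + f x z.
Proof. exact: linearDr. Qed.

Lemma dotDl x y z : f (y + z) x = f y x + f z x.
Proof. by rewrite dotC dotDr dotC (dotC x z). Qed.

Lemma dotZr a x y : f x (a *: y) = a * f x y.
Proof. exact: linearZr_LR. Qed.

Lemma dotZl a x y : f (a *: x) y = a * f x y.
Proof. by rewrite dotC dotZr dotC. Qed.

Lemma dot0r x : f x 0 = 0.
Proof. by rewrite -(scale0r 0) dotZr mul0r. Qed.

Lemma dot_gt0 x : x != 0 -> 0 < f x x.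
Proof. exact: neq0_dnorm_gt0. Qed.

Lemma dot_ge0 x : 0 <= f x x.
Proof. by have [->|/dot_gt0/ltW//] := eqVneq x 0; rewrite dot0r. Qed.

Lemma dot_CS x y : f x y <= Num.sqrt (f x x) * Num.sqrt (f y y).
Proof.
rewrite -sqrtrM ?dot_ge0//; apply: le_trans (ler_norm _) _.
rewrite -sqrtr_sqr ler_wsqrtr//.
have [->|y0] := eqVneq y 0; first by rewrite !dot0r expr0n mulr0.
have fy := dot_gt0 y0.
have := dot_ge0 (f y y *: x + (- f x y) *: y).
rewrite !(dotDl, dotDr, dotZl, dotZr) (dotC y x) => h.
have : 0 <= f y y * (f x x * f y y - f x y ^+ 2) by nra.
by rewrite pmulr_rge0// subr_ge0.
Qed.

Lemma dot_norm_triangle x y :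
  Num.sqrt (f (x + y) (x + y)) <= Num.sqrt (f x x) + Num.sqrt (f y y).
Proof.
have s0 := addr_ge0 (sqrtr_ge0 (f x x)) (sqrtr_ge0 (f y y)).
rewrite -[leRHS](ger0_norm s0) -sqrtr_sqr ler_wsqrtr//.
rewrite sqrrD !sqr_sqrtr ?dot_ge0// !(dotDl, dotDr) (dotC y x).
have := dot_CS x y; lra.
Qed.

Lemma dot_normZ a x :
  Num.sqrt (f (a *: x) (a *: x)) = `|a| * Num.sqrt (f x x).
Proof.
by rewrite dotZl dotZr mulrA -expr2 sqrtrM ?sqr_ge0// sqrtr_sqr.
Qed.

Lemma dot_norm_eq0 x : Num.sqrt (f x x) = 0 -> x = 0.
Proof.
have [//|/dot_gt0 x0] := eqVneq x 0.
by move/eqP; rewrite sqrtr_eq0 leNgt x0.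
Qed.

End DotNorm.

(* The library equips [H1 * H2] with the max norm; this alias carries the
   Hilbert structure of the sum of the inner products instead. *)
Definition hprod (H1 H2 : Type) : Type := (H1 * H2)%type.

Section HilbertProductPre.
Variables (R : realType) (H1 H2 : preHilbertType R).

HB.instance Definition _ := GRing.Lmodule.copy (hprod H1 H2) (H1 * H2)%type.

Definition hprod_inner (p q : hprod H1 H2) : R :=
  hinner p.1 q.1 + hinner p.2 q.2.

Lemma hprod_inner_sym p q :
  hprod_inner p q = (-1) ^+ false * idfun (hprod_inner q p).
Proof. by rewrite expr0 mul1r /hprod_inner dotC (dotC _ p.2). Qed.

Lemma hprod_inner_linearr p : linear_for ( *%R ) (hprod_inner p).
Proof. by move=> a u v; rewrite /hprod_inner /= !(dotDr, dotZr); ring. Qed.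

Lemma hprod_inner_linearl q :
  linear_for ( *%R ) (applyr hprod_inner q).
Proof. by move=> a u v; rewrite /hprod_inner /= !(dotDl, dotZl); ring. Qed.

Lemma hprod_inner_gt0 p : p != 0 -> 0 < hprod_inner p p.
Proof.
rewrite /hprod_inner; case: p => x y p0 /=.
have [x0|x0] := eqVneq x 0; last by rewrite ltr_pwDl ?dot_gt0 ?dot_ge0.
rewrite ltr_wpDl ?dot_ge0// dot_gt0//.
by apply: contra p0 => /eqP ->; rewrite x0.
Qed.

HB.instance Definition _ := @bilinear_isBilinear.Build R (hprod H1 H2)
  (hprod H1 H2) R ( *%R ) (idfun \; *%R) hprod_inner
  (hprod_inner_linearl, hprod_inner_linearr).
HB.instance Definition _ := @isHermitianSesquilinear.Build R (hprod H1 H2)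
  false idfun hprod_inner hprod_inner_sym.
HB.instance Definition _ := @isDotProduct.Build R (hprod H1 H2)
  hprod_inner hprod_inner_gt0.

HB.instance Definition _ := @Lmodule_isNormed.Build R (hprod H1 H2)
  (fun p => Num.sqrt (hprod_inner p p))
  (@dot_norm_triangle R (hprod H1 H2) hprod_inner)
  (@dot_normZ R (hprod H1 H2) hprod_inner)
  (@dot_norm_eq0 R (hprod H1 H2) hprod_inner).

HB.instance Definition _ := @NormedModule_isPreHilbert.Build R (hprod H1 H2)
  hprod_inner (fun=> erefl).

End HilbertProductPre.

Section HilbertProduct.
Variables (R : realType) (H1 H2 : hilbertType R).

Lemma ler_hprod_fst (p : hprod H1 H2) : `|p.1| <= `|p|.
Proof. by rewrite !hnormE ler_wsqrtr// lerDl dot_ge0. Qed.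

Lemma ler_hprod_snd (p : hprod H1 H2) : `|p.2| <= `|p|.
Proof. by rewrite !hnormE ler_wsqrtr// lerDr dot_ge0. Qed.

Lemma hprod_norm_le (p : hprod H1 H2) : `|p| <= `|p.1| + `|p.2|.
Proof.
have s0 : 0 <= `|p.1| + `|p.2| by rewrite addr_ge0.
rewrite hnormE -[leRHS](ger0_norm s0) -sqrtr_sqr ler_wsqrtr//.
rewrite sqrrD !hnormE !sqr_sqrtr ?dot_ge0// /= /hprod_inner.
rewrite -subr_ge0.
set a := hinner p.1 p.1; set b := hinner p.2 p.2.
have : 0 <= Num.sqrt a * Num.sqrt b by rewrite mulr_ge0 ?sqrtr_ge0.
lra.
Qed.

Lemma hprod_complete (F : set_system (hprod H1 H2)) :
  ProperFilter F -> cauchy F -> cvg F.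
Proof.
move=> FF /cauchy_ballP Fc.
have proj_cvg (K : hilbertType R) (pr : hprod H1 H2 -> K) :
    (forall p q, `|pr p - pr q| <= `|p - q|) -> cvg (pr @ F).
  move=> prL; apply: cauchy_cvg; apply/cauchy_ballP => e e0.
  have /= [[A B] /= [FA FB] AB] := Fc e e0.
  exists (pr @` A, pr @` B) => /=.
    by split; [apply: filterS FA|apply: filterS FB] => p ?; exists p.
  move=> [_ _] [/= [p Ap <-] [q Bq <-]].
  have /= := AB (p, q) (conj Ap Bq).
  by rewrite -!ball_normE /=; apply: le_lt_trans.
have c1 : cvg (fst @ F) by apply: proj_cvg => p q; exact: ler_hprod_fst (p - q).
have c2 : cvg (snd @ F) by apply: proj_cvg => p q; exact: ler_hprod_snd (p - q).
apply/cvg_ex; exists ((lim (fst @ F), lim (snd @ F)) : hprod H1 H2).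
apply/fcvgrPdist_lt => e e0.
have e20 : 0 < e / 2 by rewrite divr_gt0.
have /cvgrPdist_lt/(_ _ e20) n1 := c1.
have /cvgrPdist_lt/(_ _ e20) n2 := c2.
near=> p.
apply: le_lt_trans (hprod_norm_le _) _.
rewrite [e]splitr ltrD//=; first by near: p; exact: n1.
by near: p; exact: n2.
Unshelve. all: by end_near. Qed.

HB.instance Definition _ :=
  Uniform_isComplete.Build (hprod H1 H2) hprod_complete.

End HilbertProduct.

Section Coderivative.
Variable R : realType.

(* At an isolated point of [Omega] the filter is improper and [limf_esup] is
   [-oo], so that every [z] is a normal. *)
Definition frechet_normal (X : hilbertType R) (x : X) (Omega : set X) : set X :=
  [set z | (limf_esup (fun u => (hinner z (u - x) / `|u - x|)%:E)
                      (within Omega x^') <= 0)%E].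

Definition gph (H : hilbertType R) (f : H -> H) : set (hprod H H) :=
  range (fun u => (u, f u) : hprod H H).

Definition coderivative (H : hilbertType R) (f : H -> H) (x y : H) : set H :=
  [set z | frechet_normal ((x, f x) : hprod H H) (gph f) (z, - y)].

Definition is_projection (H : hilbertType R) (C : set H) (x p : H) : Prop :=
  C p /\ forall z, C z -> `|x - p| <= `|x - z|.

(* Meaningful for [C] nonempty, closed and convex, when there is exactly one
   such point; the default value is then never used. *)
Definition projection (H : hilbertType R) (C : set H) (x : H) : H :=
  xget 0 (is_projection C x).

End Coderivative.

Section Balls.
Variables (R : realType) (H : hilbertType R) (r : R).

Definition rball : set H := [set x | `|x| <= r].
Definition rball_open : set H := [set x | `|x| < r].
Definition rsphere : set H := [set x | `|x| = r].

End Balls.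

Arguments rball {R} H r.
Arguments rball_open {R} H r.
Arguments rsphere {R} H r.

(* Main.v *)
(* A Frechet coderivative of a map that is Lipschitz at a point is controlled by
   the variable of the domain alone. Off the sphere, the projection onto the
   ball is Frechet differentiable with a self-adjoint derivative A, so that the
   coderivative at y is {A y}. On the sphere, testing along the rays that enter
   the ball and along the outward normal ray shows that every z in the
   coderivative at y is y + c xbar with c >= 0 and <z, xbar> <= 0, which yields
   (a), (c) and one half of (b); the other half is Cauchy-Schwarz. *)
Require Import Defs.
From HB Require Import structures.
From mathcomp Require Import all_boot all_order all_algebra.
From mathcomp Require Import all_classical all_reals all_analysis.
From mathcomp Require Import ring lra.
Set Implicit Arguments.
Unset Strict Implicit.
Unset Printing Implicit Defensive.
Import Order.TTheory GRing.Theory Num.Theory.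
Import numFieldNormedType.Exports.

Local Open Scope classical_set_scope.
Local Open Scope ring_scope.

(** * Inner product calculus and the epsilon form of Fréchet normals *)

Section HilbertNorm.
Variables (R : realType) (H : hilbertType R).
Implicit Types x y z : H.

Lemma hinnerBr x y z : hinner x (y - z) = hinner x y - hinner x z.
Proof. exact: linearBr. Qed.

Lemma hinnerBl x y z : hinner (y - z) x = hinner y x - hinner z x.
Proof. by rewrite dotC hinnerBr !(dotC _ x). Qed.

Lemma hinner0l x : hinner 0 x = 0.
Proof. by rewrite dotC dot0r. Qed.

Lemma hinnerNl x y : hinner (- x) y = - hinner x y.
Proof. by rewrite -sub0r hinnerBl hinner0l sub0r. Qed.

Lemma hinnerxx x : hinner x x = `|x| ^+ 2.
Proof. by rewrite hnormE sqr_sqrtr// dot_ge0. Qed.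

Lemma hinner_le x y : hinner x y <= `|x| * `|y|.
Proof. by rewrite !hnormE dot_CS. Qed.

Lemma normr_hinner_le x y : `|hinner x y| <= `|x| * `|y|.
Proof. by rewrite ler_norml lerNl -hinnerNl -{1}(normrN x) !hinner_le. Qed.

Lemma sqr_normD x y :
  `|x + y| ^+ 2 = `|x| ^+ 2 + 2 * hinner x y + `|y| ^+ 2.
Proof. by rewrite -!hinnerxx !(dotDl, dotDr) (dotC _ y x); ring. Qed.

End HilbertNorm.

(** Clearing the denominator makes the inequality trivial at [u = x], so the puncture disappears. At
    an isolated point both sides hold for every [z]. *)
Lemma frechet_normalP (R : realType) (X : hilbertType R) (x z : X)
    (Omega : set X) :
  frechet_normal x Omega z <->
  forall e, 0 < e ->
    \forall u \near x, Omega u -> hinner z (u - x) <= e * `|u - x|.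
Proof.
split=> [zN e e0|zN].
  have : (limf_esup (fun u => (hinner z (u - x) / `|u - x|)%:E)
      (within Omega x^') < e%:E)%E.
    by apply: le_lt_trans zN _; rewrite lte_fin.
  move=> /ereal_inf_lt[_ [V FV <-]] supV.
  have [d /= d0 dV] := (nbhs_normP _ _).1 FV.
  apply/nbhs_normP; exists d => // u ud Ou.
  have [->|ux] := eqVneq u x; first by rewrite subrr dot0r normr0 mulr0.
  have Vu : V u by exact: dV.
  have /ltW := le_lt_trans (ereal_sup_ubound (imageP _ Vu)) supV.
  by rewrite lee_fin ler_pdivrMr// normr_gt0 subr_eq0.
(* The infimum over the filter is bounded by the supremum over one punctured ball intersected with
   [Omega]. *)
apply/lee_addgt0Pr => e e0; rewrite add0e; apply: ge_ereal_inf.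
have [d /= d0 dV] := (nbhs_normP _ _).1 (zN e e0).
eexists.
  exists [set u | [/\ Omega u, u != x & `|x - u| < d]]; last reflexivity.
  by apply/nbhs_normP; exists d => // u ud ux Ou; split.
apply: ge_ereal_sup => _ [u [Ou ux ud] <-].
rewrite lee_fin ler_pdivrMr ?normr_gt0 ?subr_eq0//.
exact: dV.
Qed.

Lemma near_ray (R : realType) (V : normedModType R) (x h : V) (P : V -> Prop) :
  (\forall u \near x, P u) -> \forall t \near 0^'+, P (x + t *: h).
Proof.
suff cv : x + t *: h @[t --> (0:R)^'+] --> x by exact: cv.
rewrite -[X in _ --> X]addr0 -(scale0r h); apply: cvgD; first exact: cvg_cst.
by apply: cvgZr_tmp; exact: cvg_at_right_filter cvg_id.
Qed.

(** * Coderivatives of maps that are Lipschitz at a point *)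

Section CoderivativeLipschitz.
Variables (R : realType) (H : hilbertType R) (f : H -> H) (x : H) (L : R).
Hypothesis fL : forall u, `|f u - f x| <= L * `|u - x|.
Implicit Types y z : H.

(** The increment on the graph has norm between [|u - x|] and [(1 + |L|) * |u - x|], so the two
    norms are interchangeable after rescaling [e]. *)
Lemma coderivativeP y z : coderivative f x y z <->
  forall e, 0 < e ->
    \forall u \near x, hinner z (u - x) - hinner y (f u - f x) <= e * `|u - x|.
Proof.
pose G u : hprod H H := (u, f u).
have L0 : 0 < 1 + `|L| by rewrite ltr_pwDl.
have GE u : hinner ((z, - y) : hprod H H) (G u - G x)
    = hinner z (u - x) - hinner y (f u - f x).
  by rewrite -hinnerNl.
have leG u : `|u - x| <= `|G u - G x| by exact: ler_hprod_fst (G u - G x).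
have Gle u : `|G u - G x| <= (1 + `|L|) * `|u - x|.
  apply: le_trans (hprod_norm_le _) _; rewrite mulrDl mul1r lerD2l/=.
  by apply: le_trans (fL u) _; rewrite ler_wpM2r// ler_norm.
split=> [/frechet_normalP zN e e0|zN].
  have e1 : 0 < e / (1 + `|L|) by rewrite divr_gt0.
  have [d /= d0 dV] := (nbhs_normP _ _).1 (zN _ e1).
  apply/nbhs_normP; exists (d / (1 + `|L|)) => /=; first by rewrite divr_gt0.
  move=> u /=; rewrite distrC ltr_pdivlMr// mulrC => ud.
  have Gud : `|G x - G u| < d by rewrite distrC (le_lt_trans (Gle u)).
  have := dV _ Gud (imageT G u); rewrite GE => /le_trans; apply.
  by rewrite mulrAC ler_pdivrMr// -mulrA ler_pM2l// mulrC.
apply/frechet_normalP => e e0.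
have [d /= d0 dV] := (nbhs_normP _ _).1 (zN e e0).
apply/nbhs_normP; exists d => //= p pd [u _ up].
move: pd; rewrite -up -[(u, f u)]/(G u) -[(x, f x)]/(G x) => pd.
rewrite GE; apply: le_trans (dV u _) _ => /=; last by rewrite ler_pM2l.
by rewrite distrC (le_lt_trans (leG u))// distrC.
Qed.

(** Along a ray where [f] is affine the inequality is homogeneous in [t]: divide by [t], then let
    [e] tend to 0. *)
Lemma coderivative_ray y z h k : coderivative f x y z ->
  (\forall t \near 0^'+, f (x + t *: h) = f x + t *: k) ->
  hinner z h <= hinner y k.
Proof.
move=> /coderivativeP zN fh; apply/ler_addgt0Pr => e e0.
have e1 : 0 < e / (1 + `|h|) by rewrite divr_gt0// ltr_pwDl.
have near_z := near_ray h (zN _ e1).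
have [t [t0 [ft zt]]] : exists t : R, 0 < t /\ f (x + t *: h) = f x + t *: k /\
    hinner z (x + t *: h - x) - hinner y (f (x + t *: h) - f x)
      <= e / (1 + `|h|) * `|x + t *: h - x|.
  near (0:R)^'+ => t; exists t; split => //; split; near: t; [exact: fh|exact: near_z].
move: zt; rewrite ft !(addrC _ (_ *: _)) !addrK !dotZr -mulrBr normrZ gtr0_norm//.
rewrite mulrCA ler_pM2l// => zt; rewrite -lerBlDl; apply: le_trans zt _.
by rewrite mulrAC ler_pdivrMr ?ltr_pwDl// ler_pM2l// lerDr.
Unshelve. all: by end_near. Qed.

(** By symmetry of [A], the tested quantity is [hinner (z - A y) (u - x)] up to o([|u - x|]). Hence
    [A y] qualifies, and any other [z] fails in the direction [z - A y]. *)
Lemma coderivative_diff (A : H -> H) y :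
  (forall e, 0 < e -> \forall u \near x,
     `|f u - f x - A (u - x)| <= e * `|u - x|) ->
  (forall u v, hinner (A u) v = hinner u (A v)) ->
  coderivative f x y = [set A y].
Proof.
move=> fA Asym.
have E z u : hinner z (u - x) - hinner y (f u - f x)
    = hinner (z - A y) (u - x) - hinner y (f u - f x - A (u - x)).
  by rewrite hinnerBl Asym (hinnerBr y (_ - _)); ring.
have fAy e : 0 < e -> \forall u \near x,
    `|hinner y (f u - f x - A (u - x))| <= e * `|u - x|.
  move=> e0; have e1 : 0 < e / (1 + `|y|) by rewrite divr_gt0// ltr_pwDl.
  apply: filterS (fA _ e1) => u hu.
  apply: le_trans (normr_hinner_le _ _) _.
  apply: le_trans (ler_wpM2l (normr_ge0 y) hu) _.
  by rewrite mulrA ler_wpM2r// mulrA ler_pdivrMr ?ltr_pwDl// mulrC ler_pM2l// lerDr.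
apply/seteqP; split=> [z /coderivativeP zN|_ ->] /=; last first.
  apply/coderivativeP => e /fAy; apply: filterS => u.
  by rewrite E subrr hinner0l sub0r ler_norml lerNl => /andP[].
apply/eqP; rewrite -subr_eq0 -normr_le0; apply/ler_addgt0Pr => e e0.
set w := z - A y in E *; rewrite add0r.
have [->|w0] := eqVneq w 0; first by rewrite normr0 ltW.
have e2 : 0 < e / 2 by rewrite divr_gt0.
(* Along [w] the two errors of [e / 2] add up to [t * |w| ^ 2 <= e * t * |w|]. *)
have near_z := near_ray w (zN _ e2); have near_A := near_ray w (fAy _ e2).
have [t [t0 [h]]] : exists t : R, 0 < t /\
    (hinner z (x + t *: w - x) - hinner y (f (x + t *: w) - f x)
      <= e / 2 * `|x + t *: w - x| /\
     `|hinner y (f (x + t *: w) - f x - A (x + t *: w - x))|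
      <= e / 2 * `|x + t *: w - x|).
  near (0:R)^'+ => t; exists t; split => //.
  by split; near: t; [exact: near_z|exact: near_A].
move: h; rewrite E (addrC x) addrK dotZr hinnerxx normrZ gtr0_norm// => h1.
rewrite ler_norml => /andP[_ h2].
have w0' : 0 < `|w| by rewrite normr_gt0.
rewrite -(ler_pM2r w0') -(ler_pM2l t0); lra.
Unshelve. all: by end_near. Qed.

End CoderivativeLipschitz.

(** * The projection onto the ball: closed form, nonexpansiveness, derivatives *)

Section BallProjection.
Variables (R : realType) (H : hilbertType R) (r : R).
Hypothesis r_gt0 : 0 < r.
Implicit Types u v w x y z : H.

Definition rball_retract u : H := if `|u| <= r then u else (r / `|u|) *: u.

Lemma rball_retract_id u : `|u| <= r -> rball_retract u = u.
Proof. by rewrite /rball_retract => ->. Qed.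

Lemma rball_retract_scale u : r <= `|u| -> rball_retract u = (r / `|u|) *: u.
Proof.
rewrite /rball_retract; case: (leP `|u| r) => // ur ru.
have -> : `|u| = r by apply/eqP; rewrite eq_le ur ru.
by rewrite divff ?scale1r// gt_eqF.
Qed.

Lemma norm_rball_retract u : `|rball_retract u| <= r.
Proof.
have [ur|ru] := leP `|u| r; first by rewrite rball_retract_id.
have u0 := lt_trans r_gt0 ru.
rewrite (rball_retract_scale (ltW ru)) normrZ.
by rewrite gtr0_norm ?divr_gt0// divfK// gt_eqF.
Qed.

(** The obtuse-angle criterion. Outside the ball the residual is a nonnegative multiple of [u], and
    Cauchy-Schwarz bounds [hinner u w] by [r * |u|]. *)
Lemma rball_retract_variational u w : `|w| <= r ->
  hinner (u - rball_retract u) (w - rball_retract u) <= 0.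
Proof.
move=> wr; have [ur|ru] := leP `|u| r.
  by rewrite rball_retract_id// subrr hinner0l.
have u0 := lt_trans r_gt0 ru.
rewrite (rball_retract_scale (ltW ru)) -{1}(scale1r u) -scalerBl dotZl hinnerBr dotZr.
rewrite hinnerxx mulr_ge0_le0//.
  by rewrite subr_ge0 ler_pdivrMr// mul1r ltW.
rewrite expr2 mulrA divfK ?gt_eqF// subr_le0 (le_trans (hinner_le _ _))//.
by rewrite mulrC ler_pM2r.
Qed.

(** The obtuse angle yields the Pythagorean inequality [projE], which gives both minimality and
    uniqueness of the minimizer. *)
Lemma projection_rball u : projection (rball H r) u = rball_retract u.
Proof.
have projE w : `|w| <= r ->
    `|u - rball_retract u| ^+ 2 + `|rball_retract u - w| ^+ 2 <= `|u - w| ^+ 2.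
  move=> /(rball_retract_variational u) h.
  have := sqr_normD (u - rball_retract u) (rball_retract u - w).
  rewrite subrKA => ->; move: h.
  rewrite (hinnerBr _ w) (hinnerBr _ (rball_retract u) w); lra.
have PP : is_projection (rball H r) u (rball_retract u).
  split=> [|w wr]; first exact: norm_rball_retract.
  rewrite -(@ler_pXn2r _ 2) ?nnegrE//.
  by apply: le_trans (projE w wr); rewrite lerDl sqr_ge0.
rewrite /projection; apply: xget_unique => // q [qr /(_ _ (norm_rball_retract u)) qmin].
have := projE q qr; move: qmin; rewrite -(@ler_pXn2r _ 2) ?nnegrE// => h1 h2.
apply/eqP; rewrite eq_sym -subr_eq0 -normr_eq0 -sqrf_eq0.
by rewrite eq_le sqr_ge0 andbT; lra.
Qed.

(** Adding the two variational inequalities gives [|p - q| ^ 2 <= hinner (u - v) (p - q)]; then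
    Cauchy-Schwarz applies. *)
Lemma rball_retract_lipschitz u v :
  `|rball_retract u - rball_retract v| <= 1 * `|u - v|.
Proof.
have h1 := rball_retract_variational u (norm_rball_retract v).
have h2 := rball_retract_variational v (norm_rball_retract u).
rewrite mul1r; set p := rball_retract u in h1 h2 *.
set q := rball_retract v in h1 h2 *.
have [->|pq] := eqVneq p q; first by rewrite subrr normr0.
have pq0 : 0 < `|p - q| by rewrite normr_gt0 subr_eq0.
rewrite -(ler_pM2r pq0) -expr2 -hinnerxx; apply: le_trans (hinner_le _ _).
move: h1 h2; rewrite !(hinnerBl, hinnerBr) (dotC _ q p); lra.
Qed.

Lemma rball_retract_diff_interior x : `|x| < r -> forall e, 0 < e ->
  \forall u \near x,
    `|rball_retract u - rball_retract x - (u - x)| <= e * `|u - x|.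
Proof.
move=> xr e e0; apply/nbhs_normP; exists (r - `|x|) => /=; first by rewrite subr_gt0.
move=> u /= ux; have ur : `|u| < r.
  rewrite -(subrK x u) (le_lt_trans (ler_normD _ _))// -ltrBrDr distrC//.
rewrite (rball_retract_id (ltW ur)) (rball_retract_id (ltW xr)) subrr normr0.
by rewrite mulr_ge0// ltW.
Qed.

(** The remainder splits into the change of the reciprocal norm acting on [h] and its second-order
    error [k] acting on [x]. They contribute 1 and 2 to the constant 3. *)
Lemma rball_retract_expansion x h : r < `|x| -> r < `|x + h| ->
  `|rball_retract (x + h) - rball_retract x -
     (r / `|x|) *: (h - (hinner h x / `|x| ^+ 2) *: x)| <= 3 / r * `|h| ^+ 2.
Proof.
move=> xr xhr; rewrite (rball_retract_scale (ltW xr)) (rball_retract_scale (ltW xhr)).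
set a := `|x| in xr *; set b := `|x + h| in xhr *.
have a0 : 0 < a by rewrite (lt_trans r_gt0).
have b0 : 0 < b by rewrite (lt_trans r_gt0).
have ba : `|b - a| <= `|h|.
  by have := ler_dist_dist (x + h) x; rewrite addrAC subrr add0r.
have bb : b ^+ 2 = a ^+ 2 + 2 * hinner h x + `|h| ^+ 2.
  by rewrite sqr_normD dotC.
(* First order terms cancel in [k], by the identity [bb]. *)
pose k := b^-1 - a^-1 + hinner h x / a ^+ 3.
have -> : (r / b) *: (x + h) - (r / a) *: x -
    (r / a) *: (h - (hinner h x / a ^+ 2) *: x)
    = (r * (b^-1 - a^-1)) *: h + (r * k) *: x.
  have -> : r * k = r / b - r / a + r / a * (hinner h x / a ^+ 2).
    by rewrite /k; field; rewrite !gt_eqF.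
  rewrite mulrBr scalerDr !scalerBr scalerA opprB !scalerDl !scaleNr.
  by rewrite [LHS](AC (2*1*2) (2*5*(1*3*4)))/=.
have ai0 : 0 < a^-1 by rewrite invr_gt0.
have bi0 : 0 < b^-1 by rewrite invr_gt0.
have ai : a^-1 <= r^-1 by rewrite lef_pV2 ?posrE//; exact: ltW.
have bi : b^-1 <= r^-1 by rewrite lef_pV2 ?posrE//; exact: ltW.
have aa : a^-1 ^+ 2 <= r^-1 ^+ 2 by rewrite !expr2; apply: ler_pM => //; exact: ltW.
have ab : a^-1 * b^-1 <= r^-1 ^+ 2 by rewrite expr2; apply: ler_pM => //; exact: ltW.
have ab0 : 0 <= a^-1 * b^-1 by rewrite mulr_ge0// ltW.
have k1 : `|b^-1 - a^-1| <= `|h| / r ^+ 2.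
  have -> : b^-1 - a^-1 = - ((b - a) * (a^-1 * b^-1)) by field; rewrite !gt_eqF.
  by rewrite normrN normrM (ger0_norm ab0) -exprVn; apply: ler_pM.
have k2 : `|k| * a <= 2 * `|h| ^+ 2 / r ^+ 2.
  (* Eliminating [hinner h x] through [bb] leaves a difference of two nonnegative quadratic terms,
     at most 3/2 and 1/2 times [|h| ^ 2 / r ^ 2]. *)
  have kE : k * a = (b - a) ^+ 2 * (a^-1 ^+ 2 / 2 + a^-1 * b^-1)
                   - `|h| ^+ 2 * a^-1 ^+ 2 / 2.
    have hE : `|h| ^+ 2 = b ^+ 2 - a ^+ 2 - 2 * hinner h x by rewrite bb; ring.
    by rewrite hE /k; field; rewrite !gt_eqF.
  have sq : (b - a) ^+ 2 <= `|h| ^+ 2.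
    by rewrite -[leLHS]real_normK ?num_real// !expr2 ler_pM.
  have q1 : (b - a) ^+ 2 * (a^-1 ^+ 2 / 2 + a^-1 * b^-1)
      <= `|h| ^+ 2 * (3 / 2 * r^-1 ^+ 2).
    apply: ler_pM => //; rewrite ?sqr_ge0//; last by lra.
    by rewrite addr_ge0// divr_ge0// sqr_ge0.
  have q1' : 0 <= (b - a) ^+ 2 * (a^-1 ^+ 2 / 2 + a^-1 * b^-1).
    by rewrite mulr_ge0 ?sqr_ge0// addr_ge0// divr_ge0// sqr_ge0.
  have q2 : `|h| ^+ 2 * a^-1 ^+ 2 <= `|h| ^+ 2 * r^-1 ^+ 2.
    by rewrite ler_wpM2l// sqr_ge0.
  have q2' : 0 <= `|h| ^+ 2 * a^-1 ^+ 2 by rewrite mulr_ge0// sqr_ge0.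
  have -> : `|k| * a = `|k * a| by rewrite normrM (gtr0_norm a0).
  by rewrite kE -exprVn ler_norml; apply/andP; split; lra.
apply: le_trans (ler_normD _ _) _; rewrite !normrZ (gtr0_norm r_gt0)//.
have -> : 3 / r * `|h| ^+ 2 = r * (`|h| / r ^+ 2) * `|h|
    + r * (2 * `|h| ^+ 2 / r ^+ 2) by field; rewrite gt_eqF.
apply: lerD; first by rewrite ler_wpM2r// ler_pM2l.
by rewrite -mulrA ler_pM2l.
Qed.

Lemma rball_retract_diff_exterior x : r < `|x| -> forall e, 0 < e ->
  \forall u \near x,
    `|rball_retract u - rball_retract x -
       (r / `|x|) *: ((u - x) - (hinner (u - x) x / `|x| ^+ 2) *: x)|
      <= e * `|u - x|.
Proof.
move=> xr e e0; apply/nbhs_normP.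
(* The first radius keeps [u] outside the ball; the second turns the quadratic remainder into
   [e * |u - x|]. *)
exists (Num.min (`|x| - r) (e * r / 3)) => /=.
  by rewrite lt_min subr_gt0 xr divr_gt0 ?mulr_gt0.
move=> u /=; rewrite lt_min => /andP[ux1 ux2].
have xu : x + (u - x) = u by rewrite addrC subrK.
have ur : r < `|u|.
  have : `|x| <= `|x - u| + `|u| by rewrite -{1}(subrK u x) ler_normD.
  lra.
have := @rball_retract_expansion x (u - x) xr; rewrite xu => /(_ ur) /le_trans.
apply; rewrite expr2 mulrA ler_wpM2r//.
by move: ux2; rewrite distrC ltr_pdivlMr// mulrAC ler_pdivrMr// => /ltW; rewrite mulrC.
Qed.

End BallProjection.

(** * Coderivatives of the projection inside, outside and on the sphere *)

Section BallProjectionCoderivative.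
Variables (R : realType) (H : hilbertType R) (r : R).
Hypothesis r_gt0 : 0 < r.
Implicit Types x y z : H.

Let lip x u := rball_retract_lipschitz r_gt0 u x.

Lemma coderivative_rball_retract_interior x y : `|x| < r ->
  coderivative (rball_retract r) x y = [set y].
Proof.
move=> xr; apply: (coderivative_diff (lip x) (A := id)) => //.
exact: rball_retract_diff_interior.
Qed.

(** The derivative is [r / |x|] times the orthogonal projection onto the complement of [x], hence
    self-adjoint. *)
Lemma coderivative_rball_retract_exterior x y : r < `|x| ->
  coderivative (rball_retract r) x y =
  [set (r / `|x|) *: (y - (hinner y x / `|x| ^+ 2) *: x)].
Proof.
move=> xr; pose A y := (r / `|x|) *: (y - (hinner y x / `|x| ^+ 2) *: x).
apply: (coderivative_diff (lip x) (A := A)) => [|u v].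
  exact: rball_retract_diff_exterior.
by rewrite /A dotZl dotZr hinnerBl hinnerBr dotZl dotZr (dotC _ x v); ring.
Qed.

(* The rays with [<h, x> < 0] enter the ball, where the projection is the
   identity; the ray through [x] leaves it, and is projected to [x]. *)
Lemma coderivative_rball_retract_sphere x y z : `|x| = r ->
  coderivative (rball_retract r) x y z ->
  (exists2 c, 0 <= c & z = y + c *: x) /\ hinner z x <= 0.
Proof.
move=> xr zN; have px : rball_retract r x = x.
  by apply: rball_retract_id; rewrite xr.
have xx : hinner x x = r ^+ 2 by rewrite hinnerxx xr.
have rr0 : 0 < r ^+ 2 by rewrite exprn_gt0.
have inward h : hinner h x < 0 -> hinner (z - y) h <= 0.
  move=> hx; rewrite hinnerBl subr_le0.
  apply: (coderivative_ray (lip x) zN).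
  (* For positive [t] below this threshold, [2 * t * hinner h x + t ^ 2 * |h| ^ 2] is nonpositive,
     so [x + t *: h] stays in the ball. *)
  have d0 : 0 < - (2 * hinner h x) / (1 + `|h| ^+ 2).
    by rewrite divr_gt0 ?ltr_pwDl ?sqr_ge0//; lra.
  near=> t; rewrite px; apply: rball_retract_id.
  have t0 : 0 < t by [].
  have td : t * (1 + `|h| ^+ 2) <= - (2 * hinner h x).
    rewrite -ler_pdivlMr ?ltr_pwDl ?sqr_ge0//.
    by near: t; exact: nbhs_right_le.
  rewrite -(@ler_pXn2r _ 2) ?nnegrE ?(ltW r_gt0)//.
  rewrite sqr_normD xr dotZr (dotC _ x) normrZ gtr0_norm//.
  have := ler_wpM2l (ltW t0) td; nra.
have outward : hinner z x <= 0.
  rewrite -(dot0r hinner y); apply: (coderivative_ray (lip x) zN).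
  near=> t; have t0 : 0 < t by [].
  have t1 : 0 < 1 + t by rewrite addr_gt0.
  have -> : x + t *: x = (1 + t) *: x by rewrite scalerDl scale1r.
  have nx : `|(1 + t) *: x| = (1 + t) * r by rewrite normrZ xr gtr0_norm.
  rewrite px scaler0 addr0 (rball_retract_scale r_gt0) nx.
    by rewrite scalerA invfM mulrCA divff ?gt_eqF// mulr1 mulVf ?scale1r// gt_eqF.
  by rewrite ler_peMl// ?lerDl ltW.
split=> //; set w := z - y in inward.
pose p := w - (hinner w x / r ^+ 2) *: x.
have pxO : hinner p x = 0.
  by rewrite /p hinnerBl dotZl xx divfK ?subrr// gt_eqF.
have wp : hinner w p = `|p| ^+ 2.
  rewrite -hinnerxx {2}/p (hinnerBr p) dotZr pxO mulr0 subr0 dotC//.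
(* The tangential part [p] of [w] is not strictly inward, so it is tilted by a small multiple of
   [- x], scaled to make the error at most [e]. *)
have p0 : p = 0.
  apply/eqP; rewrite -normr_eq0 -sqrf_eq0 eq_le sqr_ge0 andbT.
  apply/ler_addgt0Pr => e e0; rewrite add0r.
  have s0 : 0 < e / (1 + `|hinner w x|) by rewrite divr_gt0// ltr_pwDl.
  have := inward (p - (e / (1 + `|hinner w x|)) *: x).
  rewrite hinnerBl dotZl pxO xx sub0r oppr_lt0 (mulr_gt0 s0 rr0) => /(_ isT).
  rewrite hinnerBr dotZr wp subr_le0 => /le_trans; apply.
  rewrite mulrAC ler_pdivrMr ?ltr_pwDl// ler_pM2l//.
  by rewrite (le_trans (ler_norm _))// lerDr.
(* The sign of this coefficient comes from the inward direction [- x]. *)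
exists (hinner w x / r ^+ 2).
  rewrite divr_ge0 ?sqr_ge0// -oppr_le0.
  have := inward (- x); rewrite hinnerNl xx oppr_lt0 => /(_ rr0).
  by rewrite dotC hinnerNl dotC.
by apply/eqP; rewrite addrC -subr_eq -/w -subr_eq0 -/p p0.
Unshelve. all: by end_near. Qed.

(** Here [y] is a nonpositive multiple of [x], and [x] maximizes [hinner x] over the ball, so the
    tested quantity is nonpositive for every [u]. *)
Lemma coderivative_rball_retract_sphere_0 x y : `|x| = r ->
  y = (hinner y x / `|x| ^+ 2) *: x -> hinner y x <= 0 ->
  coderivative (rball_retract r) x y 0.
Proof.
move=> xr yE yx; apply/(coderivativeP (lip x)) => e e0; near=> u.
rewrite hinner0l sub0r yE dotZl (@rball_retract_id _ _ _ x) ?xr// -mulNr.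
apply: (@le_trans _ _ 0); last by rewrite mulr_ge0// ltW.
rewrite mulr_ge0_le0//.
  by rewrite -mulNr divr_ge0 ?oppr_ge0// sqr_ge0.
rewrite hinnerBr hinnerxx subr_le0 (le_trans (hinner_le _ _))// xr expr2.
by rewrite ler_pM2l// norm_rball_retract.
Unshelve. all: by end_near. Qed.

End BallProjectionCoderivative.

Theorem theorem3p2 (R : realType) (H : hilbertType R) (r : R) (r_gt0 : 0 < r)
    (xbar : H) :
  let P : H -> H := projection (rball H r) in
  [/\ rball_open H r xbar ->
        forall y : H, coderivative P xbar y = [set y],
      ~ rball H r xbar ->
        forall y : H, coderivative P xbar y =
          [set (r / `|xbar|) *: (y - (hinner y xbar / `|xbar| ^+ 2) *: xbar)]
    & rsphere H r xbar ->
        [/\ coderivative P xbar 0 = [set 0],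
            forall y : H, y <> 0 ->
              (coderivative P xbar y 0 <->
               y = (hinner y xbar / `|xbar| ^+ 2) *: xbar
               /\ hinner y xbar <= 0)
          & coderivative P xbar xbar = set0]].
Proof.
move=> P; have -> : P = rball_retract r.
  by apply/funext => u; exact: projection_rball.
split=> [xr y|/negP|].
- exact: coderivative_rball_retract_interior.
- by rewrite -ltNge => xr y; exact: coderivative_rball_retract_exterior.
rewrite /rsphere /= => xr.
have xx : hinner xbar xbar = r ^+ 2 by rewrite hinnerxx xr.
have rr0 : 0 < r ^+ 2 by rewrite exprn_gt0.
split=> [|y _|].
- apply/seteqP; split=> [z|_ ->] /=.
    move=> /(coderivative_rball_retract_sphere r_gt0 xr)[[c c0]].
    rewrite add0r => ->; rewrite dotZl xx pmulr_lle0// => c0'.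
    by have -> : c = 0 by [lra]; rewrite scale0r.
  by apply: coderivative_rball_retract_sphere_0; rewrite ?hinner0l ?mul0r ?scale0r.
- split=> [|[yE yx]]; last exact: coderivative_rball_retract_sphere_0.
  move=> /(coderivative_rball_retract_sphere r_gt0 xr)[[c c0]].
  (* From [0 = y + c *: xbar], [y] is [- c *: xbar] with [c >= 0]. *)
  move=> /esym/eqP; rewrite addr_eq0 => /eqP -> _.
  rewrite -scaleNr dotZl xx xr mulfK ?gt_eqF//; split=> //.
  by rewrite mulr_le0_ge0 ?oppr_le0// ltW.
- apply/seteqP; split=> // z.
  move=> /(coderivative_rball_retract_sphere r_gt0 xr)[[c c0] ->].
  (* The inner product with [xbar] is [(1 + c) * r ^ 2], which is positive. *)
  rewrite dotDl dotZl xx leNgt => /negP; apply.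
  by rewrite ltr_pwDl// mulr_ge0// ltW.
Qed.
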